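(* Consider a sequence of experiments indexed by the sample size $n$, with arbitrary experimental designs, satisfying the regularity conditions (Assumption R in the context). If $d_{\mathrm{avg}}=o(n)$ (restricted interference), $\alpha_{\mathrm{ext}}=o(n)$ (design mixing) and $\alpha_{\mathrm{int}}=o(n)$ (design separation), then the Horvitz–Thompson estimator $\hat\tau_{HT}$ and the Hájek estimator $\hat\tau_{HA}$ are consistent for $\tau_{EATE}$ (i.e. their differences from $\tau_{EATE}$ converge to $0$ in probability as $n\to\infty$), and $$\hat\tau_{HT}-\tau_{EATE}=O_p\big(n^{-1/2}d_{\mathrm{avg}}^{1/2}+n^{-1/2}\alpha_{\mathrm{ext}}^{1/2}+n^{-1}\alpha_{\mathrm{int}}\big),$$ $$\hat\tau_{HA}-\tau_{EATE}=O_p\big(n^{-1/2}d_{\mathrm{avg}}^{1/2}+n^{-1/2}\alpha_{\mathrm{ext}}^{1/2}+n^{-1}\alpha_{\mathrm{int}}\big).$$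
   Context: Setting. For each sample size $n$ there are units $U=\{1,\dots,n\}$ and arbitrary potential outcome functions $y_i:\{0,1\}^n\to\mathbb R$, $i\in U$. For $\mathbf z\in\{0,1\}^n$, $\mathbf z_{-i}\in\{0,1\}^{n-1}$ is $\mathbf z$ with its $i$th entry deleted, and $y_i(\mathbf z)$ is also written $y_i(z_i;\mathbf z_{-i})$. An experimental design is the probability distribution of a random vector $\mathbf Z=(Z_1,\dots,Z_n)\in\{0,1\}^n$; it is the only source of randomness. Write $Y_i=y_i(\mathbf Z)$ and $p_i=\Pr(Z_i=1)$. All objects depend on $n$, with no relation assumed between different $n$; asymptotics are as $n\to\infty$. Assumption R (regularity conditions). There are constants $k<\infty$, $q\ge 2$, $s\ge 1$ such that for all $n$ and all $i\in U$: (A) $k^{-1}\le \Pr(Z_i=1)\le 1-k^{-1}$; (B) $E[|Y_i|^q]\le k^q$; and (C) $E[|y_i(z;\mathbf Z_{-i})|^s]\le k^s$ for $z\in\{0,1\}$. Interference. $I_{ij}=1$ if $i=j$ or if $y_j(\mathbf z)\ne y_j(\mathbf z')$ for some $\mathbf z,\mathbf z'\in\{0,1\}^n$ with $\mathbf z_{-i}=\mathbf z'_{-i}$; otherwise $I_{ij}=0$. $d_{ij}=1$ if $I_{\ell i}I_{\ell j}=1$ for some $\ell\in U$, else $d_{ij}=0$; $d_{\mathrm{avg}}=n^{-1}\sum_{i,j=1}^n d_{ij}$. Mixing coefficients. $\widetilde{\mathbf Z}_i=(I_{1i}Z_1,\dots,I_{ni}Z_n)$, and $\widetilde{\mathbf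 Z}_{-i}$ is $\widetilde{\mathbf Z}_i$ with its $i$th entry deleted. For random variables $X,Y$ on the same probability space, $\alpha(X,Y)=\sup_{A\in\sigma(X),\,B\in\sigma(Y)}|\Pr(A\cap B)-\Pr(A)\Pr(B)|$. With $q$ and $s$ the maximum values such that (B) and (C) hold, $$\alpha_{\mathrm{ext}}=\frac1n\sum_{i=1}^n\sum_{j=1}^n(1-d_{ij})\big[\alpha(\widetilde{\mathbf Z}_i,\widetilde{\mathbf Z}_j)\big]^{\frac{q-2}{q}},\qquad \alpha_{\mathrm{int}}=\sum_{i=1}^n\big[\alpha(Z_i,\widetilde{\mathbf Z}_{-i})\big]^{\frac{s-1}{s}},$$ with $0^0:=0$ (if (B) or (C) holds for all exponents, the corresponding exponent $\frac{q-2}{q}$ or $\frac{s-1}{s}$ is read as $1$). Estimand: $\tau_{EATE}=n^{-1}\sum_{i=1}^n E[y_i(1;\mathbf Z_{-i})-y_i(0;\mathbf Z_{-i})]$, expectation over the (unconditional) design. Estimators: $\hat\tau_{HT}=\frac1n\sum_i \frac{Z_iY_i}{p_i}-\frac1n\sum_i\frac{(1-Z_i)Y_i}{1-p_i}$ and $\hat\tau_{HA}=\Big(\sum_i\frac{Z_iY_i}{p_i}\Big/\sum_i\frac{Z_i}{p_i}\Big)-\Big(\sum_i\frac{(1-Z_i)Y_i}{1-p_i}\Big/\sum_i\frac{1-Z_i}{1-p_i}\Big)$, where a ratio with zero denominator is assigned the value $0$. $X_n=O_p(a_n)$ means that for every $\varepsilon>0$ there is $M<\infty$ with $\Pr(|X_n|>M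 a_n)\le\varepsilon$ for all sufficiently large $n$. *)

(* Defs.v *)
From HB Require Import structures.
From mathcomp Require Import all_boot all_order all_algebra.
From mathcomp Require Import all_classical all_reals all_analysis.

Set Implicit Arguments.
Unset Strict Implicit.
Unset Printing Implicit Defensive.

Import Order.TTheory GRing.Theory Num.Theory.
Import numFieldNormedType.Exports.

Local Open Scope classical_set_scope.
Local Open Scope ring_scope.

Notation assignment n := {ffun 'I_n -> bool}.

Definition delete_entry n (i : 'I_n) (z : assignment n) : assignment n.-1 :=
  [ffun j => z (lift i j)].

Definition insert_entry n (i : 'I_n) (b : bool) (w : assignment n.-1) :
    assignment n :=
  [ffun j => if unlift i j is Some j' then w j' else b].

(* An experimental design: a probability mass function on {0,1}^n.  The random
   assignment Z is the identity map on this sample space, and a random variable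
   is a function of the assignment. *)
Record design (R : realType) (n : nat) := Design {
  mass :> assignment n -> R;
  mass_ge0 : forall z, 0 <= mass z;
  mass_sum1 : \sum_z mass z = 1 }.

Section FixedSampleSize.
Variables (R : realType) (n : nat).
Variables (P : design R n) (y : 'I_n -> assignment n -> R).

Definition Pr (A : {set assignment n}) : R := \sum_(z in A) P z.

Definition expect (X : assignment n -> R) : R := \sum_z P z * X z.

Definition treat_prob (i : 'I_n) : R := Pr [set z : assignment n | z i]%SET.

(* y_i(b ; Z_{-i}) *)
Definition potential_outcome (i : 'I_n) (b : bool) (z : assignment n) : R :=
  y i (insert_entry i b (delete_entry i z)).

(* The treatment of i affects the outcome of j. *)
Definition interferes (i j : 'I_n) : bool :=
  (i == j) ||
  [exists z : assignment n, exists z' : assignment n,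
     (delete_entry i z == delete_entry i z') && (y j z != y j z')].

Definition dependent (i j : 'I_n) : bool :=
  [exists l : 'I_n, interferes l i && interferes l j].

Definition d_avg : R := n%:R^-1 * \sum_i \sum_j (dependent i j)%:R.

Definition exposure_vec (i : 'I_n) (z : assignment n) : assignment n :=
  [ffun j => interferes j i && z j].

Definition exposure_vec_del (i : 'I_n) (z : assignment n) : assignment n.-1 :=
  delete_entry i (exposure_vec i z).

(* sigma(X) for X with values in a finite set: all preimages X^{-1}(C). *)
Definition sigma_gen (T : finType) (X : assignment n -> T) :
    {set {set assignment n}} :=
  [set X @^-1: C | C : {set T}]%SET.

Definition alpha_mix (T1 T2 : finType)
    (X1 : assignment n -> T1) (X2 : assignment n -> T2) : R :=
  sup [set r | exists A B : {set assignment n},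
         [/\ A \in sigma_gen X1, B \in sigma_gen X2 &
             r = `|Pr (A :&: B)%SET - Pr A * Pr B| ]].

(* Power with the convention 0^0 := 0 (whereas 0 `^ 0 = 1). *)
Definition pow00 (a e : R) : R := if a == 0 then 0 else a `^ e.

(* (r - c) / r, read as 1 when r = +oo. *)
Definition holder_exponent (c : R) (r : \bar R) : R :=
  if r is r0%:E then (r0 - c) / r0 else 1.

Definition alpha_ext (q : \bar R) : R :=
  n%:R^-1 * \sum_i \sum_j (1 - (dependent i j)%:R) *
    pow00 (alpha_mix (exposure_vec i) (exposure_vec j)) (holder_exponent 2 q).

Definition alpha_int (s : \bar R) : R :=
  \sum_i pow00 (alpha_mix (fun z : assignment n => z i) (exposure_vec_del i))
               (holder_exponent 1 s).

Definition tau_EATE : R :=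
  n%:R^-1 * \sum_i expect (fun z => potential_outcome i true z
                                    - potential_outcome i false z).

Definition tau_HT (z : assignment n) : R :=
  n%:R^-1 * (\sum_i (z i)%:R * y i z / treat_prob i)
  - n%:R^-1 * (\sum_i (1 - (z i)%:R) * y i z / (1 - treat_prob i)).

(* x / 0 = 0 in a field, which is the stated convention for the ratios. *)
Definition tau_HA (z : assignment n) : R :=
  (\sum_i (z i)%:R * y i z / treat_prob i)
    / (\sum_i (z i)%:R / treat_prob i)
  - (\sum_i (1 - (z i)%:R) * y i z / (1 - treat_prob i))
    / (\sum_i (1 - (z i)%:R) / (1 - treat_prob i)).

Definition rate (q s : \bar R) : R :=
  n%:R `^ (- 2^-1) * d_avg `^ 2^-1
  + n%:R `^ (- 2^-1) * (alpha_ext q) `^ 2^-1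
  + n%:R^-1 * alpha_int s.

End FixedSampleSize.

Section Sequences.
Variable R : realType.
Variables (P : forall n, design R n)
          (y : forall n, 'I_n -> assignment n -> R).

Definition treatment_bounded (k : R) : Prop :=
  forall n (i : 'I_n),
    k^-1 <= treat_prob (P n) i /\ treat_prob (P n) i <= 1 - k^-1.

Definition outcome_moment (k q : R) : Prop :=
  forall n (i : 'I_n), expect (P n) (fun z => `|y i z| `^ q) <= k `^ q.

Definition potential_moment (k s : R) : Prop :=
  forall n (i : 'I_n) (b : bool),
    expect (P n) (fun z => `|potential_outcome (@y n) i b z| `^ s) <= k `^ s.

(* r is the maximum of the exponents >= lo at which H holds, and +oo when H
   holds at all of them. *)
Definition max_exponent (lo : R) (H : R -> Prop) (r : \bar R) : Prop :=
  match r with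
  | r0%:E => [/\ lo <= r0, H r0 & forall r1, lo <= r1 -> H r1 -> r1 <= r0]
  | +oo%E => forall r1, lo <= r1 -> H r1
  | -oo%E => False
  end.

(* The constant k is fixed before the exponents are maximised.  The exponents
   satisfying a moment condition form a closed interval, so the maximum exists
   unless the condition holds for all exponents (where the exponent is +oo). *)
Definition regular (k : R) (q s : \bar R) : Prop :=
  [/\ 0 < k, treatment_bounded k,
      max_exponent 2 (outcome_moment k) q &
      max_exponent 1 (potential_moment k) s].

Definition cvg_in_prob0 (X : forall n, assignment n -> R) : Prop :=
  forall e : R, 0 < e ->
    Pr (P n) [set z | e < `|X n z|]%SET @[n --> \oo] --> (0 : R).

Definition Op_rate (X : forall n, assignment n -> R) (a : nat -> R) : Prop :=
  forall e : R, 0 < e -> exists M : R,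
    \forall n \near \oo, Pr (P n) [set z | M * a n < `|X n z|]%SET <= e.

End Sequences.

(* Main.v *)
(** Split each estimator into its two treatment arms.  The outcome of unit i is
    a function of the treatments that affect it, so two outcomes that share no
    such treatment have covariance at most a constant times the mixing
    coefficient to the power (q - 2)/q (Davydov's inequality, by truncation);
    the covariances of the other pairs are bounded by second moments.  Summing,
    the variance of an arm's weighted mean is O((d_avg + alpha_ext)/n).  Its bias
    for the arm's mean potential outcome is an average of covariances between
    Z_i and y_i(b; Z_{-i}), hence O(alpha_int/n).  Chebyshev's inequality then
    handles the Horvitz-Thompson estimator, and the Hajek estimator as well
    once the weights are known to have mean close to 1, which is the same
    variance bound applied to the constant outcome 1. *)

Require Import Defs.
From mathcomp Require Import all_boot all_order all_algebra.
From mathcomp Require Import all_classical all_reals all_analysis.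
From mathcomp Require Import ring lra.
Import Order.TTheory GRing.Theory Num.Theory.
Import numFieldNormedType.Exports.
Local Open Scope classical_set_scope.
Local Open Scope ring_scope.

Set Implicit Arguments.
Unset Strict Implicit.
Unset Printing Implicit Defensive.

(** * Expectation, covariance and mixing on a finite sample space *)

Section FiniteProbability.
Variables (R : realType) (n : nat) (P : design R n).
Implicit Types (X Y W : assignment n -> R) (A B : {set assignment n}).

Definition cov X Y : R :=
  expect P (fun z => X z * Y z) - expect P X * expect P Y.

(** On a finite sample space this is measurability of [X] with respect to the sigma-algebra
    generated by [U]. *)
Definition determined_by (T : Type) (U : assignment n -> T) X : Prop :=
  forall z z', U z = U z' -> X z = X z'.

Lemma eq_expect X Y : X =1 Y -> expect P X = expect P Y.
Proof. by move=> XY; apply: eq_bigr => z _; rewrite XY. Qed.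

Lemma expectD X Y :
  expect P (fun z => X z + Y z) = expect P X + expect P Y.
Proof. by rewrite /expect -big_split; apply: eq_bigr => z _; rewrite mulrDr. Qed.

Lemma expectZ (c : R) X : expect P (fun z => c * X z) = c * expect P X.
Proof. by rewrite /expect big_distrr; apply: eq_bigr => z _; rewrite mulrCA. Qed.

Lemma expectB X Y :
  expect P (fun z => X z - Y z) = expect P X - expect P Y.
Proof.
by rewrite /expect -sumrB; apply: eq_bigr => z _; rewrite mulrBr.
Qed.

Lemma expect_cst (c : R) : expect P (fun=> c) = c.
Proof. by rewrite /expect -big_distrl /= mass_sum1 mul1r. Qed.

Lemma expect_sum (I : finType) (F : I -> assignment n -> R) :
  expect P (fun z => \sum_i F i z) = \sum_i expect P (F i).
Proof.
by rewrite /expect exchange_big; apply: eq_bigr => z _; rewrite big_distrr.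
Qed.

Lemma ler_expect X Y : (forall z, X z <= Y z) -> expect P X <= expect P Y.
Proof. by move=> XY; apply: ler_sum => z _; rewrite ler_wpM2l ?mass_ge0. Qed.

Lemma expect_ge0 X : (forall z, 0 <= X z) -> 0 <= expect P X.
Proof. by move=> X0; apply: sumr_ge0 => z _; rewrite mulr_ge0 ?mass_ge0. Qed.

Lemma normr_expect X : `|expect P X| <= expect P (fun z => `|X z|).
Proof.
apply: le_trans (ler_norm_sum _ _ _) _; apply: ler_sum => z _.
by rewrite normrM (ger0_norm (mass_ge0 _ _)).
Qed.

Lemma expect_indicator A : expect P (fun z => (z \in A)%:R) = Pr P A.
Proof.
rewrite /expect /Pr [RHS]big_mkcond; apply: eq_bigr => z _.
by case: (z \in A); rewrite ?mulr1 ?mulr0.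
Qed.

Lemma Pr_ge0 A : 0 <= Pr P A.
Proof. by apply: sumr_ge0 => z _; apply: mass_ge0. Qed.

Lemma le_Pr A B : A \subset B -> Pr P A <= Pr P B.
Proof.
move=> /fintype.subsetP AB; rewrite -!expect_indicator; apply: ler_expect => z.
by case: (boolP (z \in A)) => [/AB ->|_]; rewrite ?ler0n.
Qed.

Lemma Pr_le1 A : Pr P A <= 1.
Proof.
rewrite -expect_indicator -[leRHS](expect_cst 1); apply: ler_expect => z.
by case: (z \in A).
Qed.

Lemma Pr_setU A B : Pr P (A :|: B)%SET <= Pr P A + Pr P B.
Proof.
rewrite -!expect_indicator -expectD; apply: ler_expect => z.
by rewrite finset.in_setU; case: (z \in A); case: (z \in B) => //=; lra.
Qed.

Lemma chebyshev_Pr X (t : R) : 0 < t ->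
  Pr P [set z | t < `|X z|]%SET <= expect P (fun z => X z ^+ 2) / t ^+ 2.
Proof.
move=> t0; rewrite -expect_indicator ler_pdivlMr ?exprn_gt0// mulrC -expectZ.
apply: ler_expect => z; rewrite inE; case: ltP => tX; rewrite ?mulr0 ?sqr_ge0//.
rewrite mulr1 -(real_normK (num_real (X z))).
by rewrite ler_pXn2r ?nnegrE ?(ltW t0) ?(ltW tX) ?normr_ge0.
Qed.

Lemma covC X Y : cov X Y = cov Y X.
Proof.
by rewrite /cov mulrC; congr (_ - _); apply: eq_expect => z; rewrite mulrC.
Qed.

Lemma covDl X X' Y : cov (fun z => X z + X' z) Y = cov X Y + cov X' Y.
Proof.
rewrite /cov (eq_expect (Y := fun z => X z * Y z + X' z * Y z)) ?expectD.
  by rewrite ?expectD; ring.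
by move=> z; rewrite mulrDl.
Qed.

Lemma covZl (c : R) X Y : cov (fun z => c * X z) Y = c * cov X Y.
Proof.
rewrite /cov expectZ (eq_expect (Y := fun z => c * (X z * Y z))) ?expectZ.
  by rewrite ?expectZ; ring.
by move=> z; rewrite mulrA.
Qed.

Lemma cov_centered X Y :
  cov X Y = \sum_z P z * (X z * (Y z - expect P Y)).
Proof.
rewrite /cov [X in _ - X]mulrC -expectZ -expectB /expect.
by apply: eq_bigr => z _; ring.
Qed.

Lemma eq_cov X X' Y Y' : X =1 X' -> Y =1 Y' -> cov X Y = cov X' Y'.
Proof. by move=> /funext -> /funext ->. Qed.

(* The extremal bounded U-measurable variable is the sign of E[Y - E Y | U]. *)
Lemma cov_le_indicator (T : finType) (U : assignment n -> T) X Y (M : R) :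
  determined_by U X -> (forall z, `|X z| <= M) ->
  exists S : {set T}, `|cov X Y| <= 2 * M * `|cov (fun z => (U z \in S)%:R) Y|.
Proof.
move=> UX XM.
have M0 : 0 <= M by apply: le_trans (XM [ffun=> false]).
(* [c u] is the conditional mean of the centred [Y] on the fibre [U = u], weighted by the
   probability of the fibre. *)
pose c u := \sum_(z | U z == u) P z * (Y z - expect P Y).
have sumc : \sum_u c u = 0.
  transitivity (expect P (fun z => Y z - expect P Y)).
    by rewrite /expect (partition_big U xpredT).
  by rewrite expectB expect_cst subrr.
pose S := [set u | 0 <= c u]%SET; exists S.
have covS : cov (fun z => (U z \in S)%:R) Y = \sum_u (u \in S)%:R * c u.
  rewrite cov_centered (partition_big U xpredT)//=; apply: eq_bigr => u _.
  by rewrite /c big_distrr /=; apply: eq_bigr => z /eqP ->; rewrite mulrCA.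
(* The [c u] sum to zero, so their positive and negative parts have equal mass and the absolute sum
   is twice the positive part. *)
have abs_c : \sum_u `|c u| = 2 * cov (fun z => (U z \in S)%:R) Y.
  rewrite covS; transitivity (2 * (\sum_u (u \in S)%:R * c u) - \sum_u c u).
    rewrite mulr_sumr -sumrB; apply: eq_bigr => u _.
    rewrite inE; case: (leP 0 (c u)) => cu; first by rewrite ger0_norm//=; ring.
    by rewrite ltr0_norm//=; ring.
  by rewrite sumc subr0.
have -> : 2 * M * `|cov (fun z => (U z \in S)%:R) Y| = M * \sum_u `|c u|.
  rewrite abs_c mulrAC mulrC; congr (_ * _).
  rewrite -[in RHS](ger0_norm (x := 2 * _)) -?abs_c ?sumr_ge0// ?abs_c.
  by rewrite normrM ger0_norm.
rewrite cov_centered (partition_big U xpredT)//= big_distrr /=.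
apply: le_trans (ler_norm_sum _ _ _) _; apply: ler_sum => u _.
(* [X] is constant on a nonempty fibre; an empty one contributes nothing. *)
have [z0 /eqP Uz0|noz] := pickP [pred z | U z == u].
  have -> : \sum_(z | U z == u) P z * (X z * (Y z - expect P Y)) = X z0 * c u.
    rewrite /c big_distrr /=; apply: eq_bigr => z /eqP Uz.
    by rewrite (UX z z0) ?Uz ?Uz0// mulrCA.
  by rewrite normrM ler_wpM2r.
by rewrite big_pred0// normr0 mulr_ge0.
Qed.

Lemma Pr_dependence_le1 A B : `|Pr P (A :&: B)%SET - Pr P A * Pr P B| <= 1.
Proof.
have := Pr_ge0 (A :&: B); have := Pr_le1 (A :&: B).
have h1 : 0 <= Pr P A * Pr P B by rewrite mulr_ge0 ?Pr_ge0.
have h2 : Pr P A * Pr P B <= 1 by rewrite mulr_ile1 ?Pr_ge0 ?Pr_le1.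
by move=> *; rewrite ler_norml; apply/andP; split; lra.
Qed.

(** The covariance of two indicators is the dependence between two preimages, one of the values in
    the supremum, which is bounded above by 1. *)
Lemma alpha_mix_ge_cov (T1 T2 : finType) (U : assignment n -> T1)
    (V : assignment n -> T2) (S : {set T1}) (T : {set T2}) :
  `|cov (fun z => (U z \in S)%:R) (fun z => (V z \in T)%:R)|
    <= alpha_mix P U V.
Proof.
apply: ub_le_sup; first by exists 1 => _ [A [B [_ _ ->]]]; apply: Pr_dependence_le1.
exists (U @^-1: S)%SET, (V @^-1: T)%SET; split.
- by apply/imsetP; exists S.
- by apply/imsetP; exists T.
rewrite /cov -!expect_indicator; congr `|_ - _ * _|; apply: eq_expect => z;
  by rewrite ?inE// -natrM mulnb.
Qed.

Lemma alpha_mix_ge0 (T1 T2 : finType) (U : assignment n -> T1)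
    (V : assignment n -> T2) : 0 <= alpha_mix P U V.
Proof.
exact: le_trans (alpha_mix_ge_cov U V finset.set0 finset.set0).
Qed.

(** [cov_le_indicator] replaces [X], then [Y], by an indicator; each replacement costs a factor 2,
    hence the 4. *)
Lemma cov_bounded (T1 T2 : finType) (U : assignment n -> T1)
    (V : assignment n -> T2) X Y (M N : R) :
  determined_by U X -> determined_by V Y ->
  (forall z, `|X z| <= M) -> (forall z, `|Y z| <= N) ->
  `|cov X Y| <= 4 * M * N * alpha_mix P U V.
Proof.
move=> UX VY XM YN.
have M0 : 0 <= M by apply: le_trans (XM [ffun=> false]).
have N0 : 0 <= N by apply: le_trans (YN [ffun=> false]).
have [S XS] := cov_le_indicator Y UX XM.
have [T YT] := cov_le_indicator (fun z => (U z \in S)%:R) VY YN.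
apply: (le_trans XS).
rewrite covC; apply: (@le_trans _ _ (2 * M * (2 * N * alpha_mix P U V))).
  rewrite ler_wpM2l ?mulr_ge0//; apply: (le_trans YT).
  by rewrite ler_wpM2l ?mulr_ge0// covC alpha_mix_ge_cov.
by rewrite le_eqVlt; apply/orP; left; apply/eqP; ring.
Qed.

(** * Covariance inequalities under moment conditions *)

(** Large values become 0 rather than [L], so that the remainder is [X] itself beyond the level and
    0 elsewhere. *)
Definition truncate (L : R) X z : R := if `|X z| <= L then X z else 0.
Definition tail (L : R) X z : R := if `|X z| <= L then 0 else X z.

Lemma truncateD_tail L X z : X z = truncate L X z + tail L X z.
Proof. by rewrite /truncate /tail; case: ifP; rewrite ?addr0 ?add0r. Qed.

Lemma truncate_le L X z : 0 <= L -> `|truncate L X z| <= L.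
Proof. by move=> L0; rewrite /truncate; case: ifP; rewrite ?normr0. Qed.

Lemma truncate_determined (T : Type) (U : assignment n -> T) L X :
  determined_by U X -> determined_by U (truncate L X).
Proof. by move=> UX z z' zz'; rewrite /truncate (UX _ _ zz'). Qed.

Lemma cov_split L X Y :
  cov X Y = cov (truncate L X) Y + cov (tail L X) Y.
Proof. by rewrite -covDl; apply: eq_cov => // z; apply: truncateD_tail. Qed.

Definition moment_le (K r : R) X : Prop :=
  expect P (fun z => `|X z| `^ r) <= K `^ r.

(** Beyond the level [L], the power [c] of the modulus is at most [L^(c - r)] times its power [r];
    the choice [L = K t^(-1/r)] yields the stated power of [t]. Later [t] is either 1 or the mixing
    coefficient. *)
Lemma tail_moment (K r c t : R) X : 0 < K -> 0 < c -> c <= r -> 0 < t ->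
  moment_le K r X ->
  expect P (fun z => `|tail (K * t `^ (- r^-1)) X z| `^ c)
    <= K `^ c * t `^ ((r - c) / r).
Proof.
move=> K0 c0 cr t0 HX; set L := K * _.
have r0 : 0 < r by apply: lt_le_trans cr.
have L0 : 0 < L by rewrite mulr_gt0 ?powR_gt0.
apply: (@le_trans _ _ (L `^ (c - r) * expect P (fun z => `|X z| `^ r))).
  rewrite -expectZ; apply: ler_expect => z; rewrite /tail.
  (* Positivity of [c] matters here: for [powR], zero to the power zero is 1. *)
  case: (leP `|X z| L) => XL; first by rewrite normr0 powR0 ?gt_eqF// mulr_ge0 ?powR_ge0.
  have X0 : 0 < `|X z| by apply: lt_trans XL.
  have -> : `|X z| `^ c = `|X z| `^ (c - r) * `|X z| `^ r.
    by rewrite -powRD ?subrK// (gt_eqF X0) implybT.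
  rewrite ler_wpM2r ?powR_ge0// -(opprB r c) !powRN lef_pV2 ?posrE ?powR_gt0//.
  by rewrite ge0_ler_powR ?nnegrE ?subr_ge0// ltW.
apply: (@le_trans _ _ (L `^ (c - r) * K `^ r)).
  by rewrite ler_wpM2l ?powR_ge0.
rewrite /L powRM ?powR_ge0 ?(ltW K0)// -powRrM mulrAC -powRD; last first.
  by rewrite (gt_eqF K0) implybT.
rewrite subrK le_eqVlt; apply/orP; left; apply/eqP; congr (_ * _ `^ _).
by field; rewrite gt_eqF.
Qed.

Lemma cov_le_bound_mean X Y (N : R) : (forall z, `|X z| <= N) ->
  `|cov X Y| <= 2 * N * expect P (fun z => `|Y z|).
Proof.
move=> XN; have N0 : 0 <= N by apply: le_trans (XN [ffun=> false]).
have h1 : `|expect P (fun z => X z * Y z)| <= N * expect P (fun z => `|Y z|).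
  apply: le_trans (normr_expect _) _; rewrite -expectZ; apply: ler_expect => z.
  by rewrite normrM ler_wpM2r.
have h2 : `|expect P X * expect P Y| <= N * expect P (fun z => `|Y z|).
  rewrite normrM ler_pM//; last exact: normr_expect.
  by apply: le_trans (normr_expect _) _; rewrite -[leRHS]expect_cst ler_expect.
by apply: le_trans (ler_normB _ _) _; lra.
Qed.

Lemma sqr_expect_le X : expect P X ^+ 2 <= expect P (fun z => X z ^+ 2).
Proof.
set m := expect P X.
have : 0 <= expect P (fun z => (X z - m) ^+ 2).
  by apply: expect_ge0 => z; apply: sqr_ge0.
rewrite (eq_expect (Y := fun z => X z ^+ 2 - (2 * m * X z - m ^+ 2))); last first.
  by move=> z; ring.
rewrite !expectB expectZ expect_cst -/m.
by rewrite (_ : 2 * m * m - m ^+ 2 = m ^+ 2) ?subr_ge0//; ring.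
Qed.

(** Products are bounded by half the sum of squares. This additive form suffices because both
    variables obey the same moment bound wherever it is applied. *)
Lemma cov_le_second_moments X Y :
  `|cov X Y| <= expect P (fun z => X z ^+ 2) + expect P (fun z => Y z ^+ 2).
Proof.
have prod_le (x y : R) : `|x * y| <= 2^-1 * (x ^+ 2 + y ^+ 2).
  have := sqr_ge0 (x - y); have := sqr_ge0 (x + y); rewrite sqrrD sqrrB => ? ?.
  by rewrite ler_norml; apply/andP; split; lra.
have h1 : `|expect P (fun z => X z * Y z)|
    <= 2^-1 * (expect P (fun z => X z ^+ 2) + expect P (fun z => Y z ^+ 2)).
  rewrite -expectD -expectZ; apply: le_trans (normr_expect _) _.
  exact: ler_expect.
have h2 := prod_le (expect P X) (expect P Y).
have := sqr_expect_le X; have := sqr_expect_le Y.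
by move=> hX hY; apply: le_trans (ler_normB _ _) _; lra.
Qed.

Lemma expect_powR2 X :
  expect P (fun z => `|X z| `^ 2) = expect P (fun z => X z ^+ 2).
Proof.
by apply: eq_expect => z; rewrite powR_mulrn// real_normK ?num_real.
Qed.

Lemma expect_powR1 X :
  expect P (fun z => `|X z| `^ 1) = expect P (fun z => `|X z|).
Proof. by apply: eq_expect => z; rewrite powRr1. Qed.

(** The part up to [K] contributes at most [K], and so does the tail, by [tail_moment] at
    [t = 1]. *)
Lemma first_moment_le (K r : R) X : 0 < K -> 1 <= r -> moment_le K r X ->
  expect P (fun z => `|X z|) <= 2 * K.
Proof.
move=> K0 r1 HX; have := tail_moment K0 ltr01 r1 ltr01 HX.
rewrite expect_powR1 !powR1 !mulr1 powRr1 ?(ltW K0)// => HT.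
apply: (@le_trans _ _ (K + expect P (fun z => `|tail K X z|))); last by lra.
rewrite -[X in X + _](expect_cst K) -expectD; apply: ler_expect => z.
rewrite (truncateD_tail K X z); apply: le_trans (ler_normD _ _) _.
by rewrite lerD2r truncate_le ?ltW// -truncateD_tail.
Qed.

Lemma second_moment_le (K r : R) X : 0 < K -> 2 <= r -> moment_le K r X ->
  expect P (fun z => X z ^+ 2) <= 2 * K ^+ 2.
Proof.
move=> K0 r2 HX; have := tail_moment K0 (ltr0Sn _ 1) r2 ltr01 HX.
rewrite expect_powR2 !powR1 !mulr1 powR_mulrn ?(ltW K0)// => HT.
apply: (@le_trans _ _ (K ^+ 2 + expect P (fun z => tail K X z ^+ 2))); last by lra.
rewrite -[X in X + _](expect_cst (K ^+ 2)) -expectD; apply: ler_expect => z.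
rewrite /tail; case: (leP `|X z| K) => XK; last by rewrite lerDr sqr_ge0.
by rewrite expr0n addr0 -real_normK ?num_real// lerXn2r ?nnegrE// ltW.
Qed.

Lemma bounded_fun X : exists M, forall z, `|X z| <= M.
Proof.
by exists (\sum_z `|X z|) => z; rewrite (bigD1 z)//= lerDl sumr_ge0.
Qed.

Section Mixing.
Variables (T1 T2 : finType) (U : assignment n -> T1) (V : assignment n -> T2).
Variables (X Y : assignment n -> R).
Hypotheses (UX : determined_by U X) (VY : determined_by V Y).
Let a : R := alpha_mix P U V.

(** Settles the case where [pow00] is 0 and truncation at a negative power of [a] makes no sense.
    Variables on a finite space are bounded, so [cov_bounded] applies. *)
Lemma cov_eq0 : a = 0 -> cov X Y = 0.
Proof.
move=> a0; have [M XM] := bounded_fun X; have [N YN] := bounded_fun Y.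
have := cov_bounded UX VY XM YN; rewrite -/a a0 mulr0 normr_le0.
by move/eqP.
Qed.

(* Truncation at K a^(-1/s) balances the bounded part against the tail. *)
Lemma cov_le_alpha_bounded (N K s : R) : 0 < K -> 1 <= s ->
  (forall z, `|X z| <= N) -> moment_le K s Y ->
  `|cov X Y| <= 6 * N * K * pow00 a ((s - 1) / s).
Proof.
move=> K0 s1 XN HY; rewrite /pow00; case: eqP => [a0|/eqP an0].
  by rewrite cov_eq0// normr0 mulr0.
have N0 : 0 <= N by apply: le_trans (XN [ffun=> false]).
have a_gt0 : 0 < a by rewrite lt_neqAle eq_sym an0 alpha_mix_ge0.
pose L := K * a `^ (- s^-1).
have L0 : 0 <= L by rewrite mulr_ge0 ?powR_ge0// ltW.
have La : L * a = K * a `^ ((s - 1) / s).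
  rewrite /L -mulrA -{2}(powRr1 (ltW a_gt0)) -powRD ?an0 ?implybT//.
  by congr (_ * _ `^ _); field; rewrite gt_eqF// (lt_le_trans ltr01).
have HT := tail_moment K0 ltr01 s1 a_gt0 HY.
rewrite expect_powR1 -/L powRr1 ?(ltW K0)// in HT.
have h1 := cov_bounded UX (truncate_determined L VY) XN
  (fun z => truncate_le Y z L0).
have h2 := cov_le_bound_mean (tail L Y) XN.
rewrite covC (cov_split L) ![cov _ X]covC.
apply: le_trans (ler_normD _ _) _.
apply: le_trans (lerD h1 h2) _.
have -> : 6 * N * K * a `^ ((s - 1) / s) =
  4 * N * L * a + 2 * N * (K * a `^ ((s - 1) / s)).
  by rewrite -[4 * N * L * a]mulrA La; ring.
by rewrite lerD2l ler_wpM2l// mulr_ge0.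
Qed.

(** Both variables are truncated at [K a^(-1/r)]. In units of [K^2 a^((r - 2)/r)], the bounded pair
    contributes 4, each mixed pair 2, and the pair of tails 1 + 1, which adds up to 10. *)
Lemma davydov (K r : R) : 0 < K -> 2 <= r ->
  moment_le K r X -> moment_le K r Y ->
  `|cov X Y| <= 10 * K ^+ 2 * pow00 a ((r - 2) / r).
Proof.
move=> K0 r2 HX HY; rewrite /pow00; case: eqP => [a0|/eqP an0].
  by rewrite cov_eq0// normr0 mulr0.
have a_gt0 : 0 < a by rewrite lt_neqAle eq_sym an0 alpha_mix_ge0.
have r1 : 1 <= r by lra.
have r_neq0 : r != 0 by rewrite gt_eqF//; lra.
pose L := K * a `^ (- r^-1); pose theta := a `^ ((r - 2) / r).
have L0 : 0 <= L by rewrite mulr_ge0 ?powR_ge0// ltW.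
have La1 : L * (K * a `^ ((r - 1) / r)) = K ^+ 2 * theta.
  rewrite /L mulrACA -expr2 -powRD ?an0 ?implybT//.
  by congr (_ * _ `^ _); field.
have La : L * L * a = K ^+ 2 * theta.
  have -> : theta = a `^ (- r^-1 + - r^-1 + 1) by congr (_ `^ _); field.
  by rewrite !powRD ?an0 ?implybT// powRr1 ?(ltW a_gt0)// /L; ring.
have mean_tail W : moment_le K r W ->
    2 * L * expect P (fun z => `|tail L W z|) <= 2 * (K ^+ 2 * theta).
  move=> HW; rewrite -La1 -mulrA ler_wpM2l// ler_wpM2l//.
  have := tail_moment K0 ltr01 r1 a_gt0 HW.
  by rewrite expect_powR1 powRr1 ?(ltW K0).
have sqr_tail W : moment_le K r W ->
    expect P (fun z => tail L W z ^+ 2) <= K ^+ 2 * theta.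
  move=> HW; have := tail_moment K0 (ltr0Sn _ 1) r2 a_gt0 HW.
  by rewrite expect_powR2 powR_mulrn ?(ltW K0).
have hL W z := truncate_le W z L0.
have h11 := cov_bounded (truncate_determined L UX) (truncate_determined L VY)
  (hL X) (hL Y).
have h12 := cov_le_bound_mean (tail L Y) (hL X).
have h21 := cov_le_bound_mean (tail L X) (hL Y).
have h22 := cov_le_second_moments (tail L X) (tail L Y).
rewrite (cov_split L) covC [cov (tail _ _) _]covC !(cov_split L Y).
rewrite [cov (truncate L Y) (truncate L X)]covC.
rewrite [cov (tail L Y) (truncate L X)]covC.
rewrite [cov (tail L Y) (tail L X)]covC.
have := mean_tail _ HX; have := mean_tail _ HY.
have := sqr_tail _ HX; have := sqr_tail _ HY.
move: h11; rewrite -/a -[4 * L * L]mulrA -[4 * _ * a]mulrA La => h11.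
rewrite -[10 * _ * _]mulrA -/theta => e1 e2 e3 e4.
apply: le_trans (ler_normD _ _) _.
apply: le_trans (lerD (ler_normD _ _) (ler_normD _ _)) _.
lra.
Qed.

End Mixing.
End FiniteProbability.

(* For q = +oo every finite exponent r is available, and r tends to +oo. *)
Lemma max_exponent_bound (R : realType) (c : R) (H : R -> Prop) (q : \bar R)
    (a x C : R) : 0 < c -> 0 <= a -> max_exponent c H q ->
  (forall r, c <= r -> H r -> x <= C * pow00 a ((r - c) / r)) ->
  x <= C * pow00 a (holder_exponent c q).
Proof.
move=> c0 a0; case: q => [r0|/=|//] /=; first by case=> cr0 Hr0 _; apply.
move=> Hall Hx; have {}Hx r : c <= r -> x <= C * pow00 a ((r - c) / r).
  by move=> cr; apply: Hx => //; apply: Hall.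
(* If [a = 0], the bound is 0 at every exponent, and [r = c] already gives it. *)
move: Hx; rewrite /pow00; case: eqP => [_ /(_ c (lexx _))//|/eqP an0 Hx].
have a_gt0 : 0 < a by rewrite lt_neqAle eq_sym an0.
(* Written with [expR], the bound at exponent [1 - e] is visibly continuous in [e]; its value at 0
   is the goal. *)
pose g (e : R) := C * expR ((1 - e) * ln a).
have gE e : C * a `^ (1 - e) = g e by rewrite /powR (negPf an0).
suff : x <= g 0 by rewrite -gE subr0.
have g_cont : g e @[e --> 0^'+] --> g 0.
  apply: cvg_at_right_filter; apply: cvgM; first exact: cvg_cst.
  apply: continuous_cvg; first exact: continuous_expR.
  apply: cvgM; last exact: cvg_cst.
  by apply: cvgB; [exact: cvg_cst|exact: cvg_id].
apply: (ler_cvg_to (cvg_cst x) g_cont).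
near=> e; rewrite -gE.
have e0 : 0 < e by near: e; exact: nbhs_right_gt.
have e1 : e <= 1 by near: e; exact: nbhs_right_le.
(* The exponent [1 - e] is reached at [r = c / e], which is at least [c] because [e <= 1]. *)
have -> : 1 - e = (c / e - c) / (c / e) by field; rewrite !gt_eqF.
by apply: Hx; rewrite ler_pdivlMr// ler_piMr// ltW.
Unshelve. all: by end_near.
Qed.

Lemma max_exponent_ex (R : realType) (c : R) (H : R -> Prop) (q : \bar R) :
  max_exponent c H q -> exists2 r, c <= r & H r.
Proof.
by case: q => [r0 [cr0 Hr0 _]|Hall|//]; [exists r0 | exists c => //; apply: Hall].
Qed.

(** * Mean-square error of the arm estimators *)

Section FixedSampleSize.
Variables (R : realType) (n : nat) (P : design R n).
Variable y : 'I_n -> assignment n -> R.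
Implicit Types (i j : 'I_n) (b : bool) (z : assignment n).

(** [interferes] only compares assignments that differ in one entry, so the differing entries are
    changed one at a time, by induction on their number. *)
Lemma eq_outcome i z z' :
  (forall j, z j != z' j -> ~~ interferes y j i) -> y i z = y i z'.
Proof.
have [m] := ubnP #|[set j | z j != z' j]%SET|.
elim: m z => // m IH z; rewrite ltnS => hm hI.
have [j zj|eqz] := pickP [pred j | z j != z' j]; last first.
  by congr (y i _); apply/ffunP => j; apply/eqP; move: (eqz j) => /= /negbFE.
pose z1 : assignment n := [ffun l => if l == j then z' j else z l].
have diffE l : (z1 l != z' l) = (l != j) && (z l != z' l).
  by rewrite ffunE; case: (eqVneq l j) => [->|//]; rewrite eqxx.
transitivity (y i z1).
  (* [z] and [z1] agree after deletion of entry [j], and [j] does not affect the outcome of [i]. *)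
  move: (hI j zj); rewrite negb_or => /andP[_] /existsPn /(_ z) /existsPn /(_ z1).
  rewrite negb_and => /orP[|/negPn/eqP//] /negP[]; apply/eqP/ffunP => l.
  by rewrite !ffunE eq_sym (negPf (neq_lift _ _)).
apply: IH; last by move=> l; rewrite diffE => /andP[_] /hI.
apply: leq_trans hm; apply: proper_card; apply/properP; split.
  by apply/fintype.subsetP => l; rewrite !inE diffE => /andP[].
by exists j; rewrite inE// diffE eqxx.
Qed.

Lemma outcome_determined i : determined_by (exposure_vec y i) (y i).
Proof.
move=> z z' /ffunP zz'; apply: eq_outcome => j; apply: contraNN => Iji.
by move: (zz' j); rewrite !ffunE Iji => /= ->.
Qed.

Lemma treatment_determined i (f : bool -> R) :
  determined_by (exposure_vec y i) (fun z => f (z i)).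
Proof.
by move=> z z' /ffunP /(_ i); rewrite !ffunE /interferes eqxx /= => ->.
Qed.

(** Insertion overwrites entry [i], so only the other treatments affecting [i] remain. *)
Lemma potential_outcome_determined i b :
  determined_by (exposure_vec_del y i) (potential_outcome y i b).
Proof.
move=> z z' /ffunP zz'; apply: outcome_determined; apply/ffunP => j.
rewrite !ffunE; case: (unliftP i j) => [j' ->|->//].
by move: (zz' j'); rewrite !ffunE.
Qed.

Lemma potential_outcome_observed i z : potential_outcome y i (z i) z = y i z.
Proof.
congr (y i _); apply/ffunP => j; rewrite !ffunE.
by case: (unliftP i j) => [j' ->|->//]; rewrite !ffunE.
Qed.

Lemma cov_suml (I : finType) (F : I -> assignment n -> R) X :
  cov P (fun z => \sum_i F i z) X = \sum_i cov P (F i) X.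
Proof.
rewrite /cov (eq_expect P (Y := fun z => \sum_i F i z * X z)); last first.
  by move=> z; rewrite big_distrl.
by rewrite !expect_sum big_distrl -sumrB.
Qed.

Lemma cov_mean (F : 'I_n -> assignment n -> R) :
  cov P (fun z => n%:R^-1 * \sum_i F i z) (fun z => n%:R^-1 * \sum_i F i z) =
    n%:R^-1 ^+ 2 * \sum_i \sum_j cov P (F i) (F j).
Proof.
rewrite covZl covC covZl mulrA -expr2; congr (_ * _).
rewrite cov_suml exchange_big; apply: eq_bigr => i _ /=.
by rewrite covC cov_suml; apply: eq_bigr => j _; rewrite covC.
Qed.

Lemma mean_square_dev X (m : R) :
  expect P (fun z => (X z - m) ^+ 2) = cov P X X + (expect P X - m) ^+ 2.
Proof.
rewrite (eq_expect P (Y := fun z => X z * X z - (2 * m * X z - m ^+ 2))).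
  by rewrite !expectB expectZ expect_cst /cov; ring.
by move=> z; ring.
Qed.

(** Pairs are compared term by term: a dependent pair is charged to [d_avg], any other to
    [alpha_ext] by [davydov]. The family [F] is general so as to cover both weighted outcomes and
    bare weights. *)
Lemma variance_mean (K : R) (H : R -> Prop) (q : \bar R)
    (F : 'I_n -> assignment n -> R) :
  0 < K -> max_exponent 2 H q ->
  (forall i, determined_by (exposure_vec y i) (F i)) ->
  (forall r, 2 <= r -> H r -> forall i, moment_le P K r (F i)) ->
  cov P (fun z => n%:R^-1 * \sum_i F i z) (fun z => n%:R^-1 * \sum_i F i z) <=
    10 * K ^+ 2 * (n%:R^-1 * (d_avg y + alpha_ext P y q)).
Proof.
move=> K0 Hq FU HF; rewrite cov_mean.
have -> : 10 * K ^+ 2 * (n%:R^-1 * (d_avg y + alpha_ext P y q)) =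
    n%:R^-1 ^+ 2 * \sum_i \sum_j (10 * K ^+ 2 * ((dependent y i j)%:R +
      (1 - (dependent y i j)%:R) *
        pow00 (alpha_mix P (exposure_vec y i) (exposure_vec y j))
              (holder_exponent 2 q))).
  rewrite /d_avg /alpha_ext -mulrDr -big_split /= [n%:R^-1 * (_ * _)]mulrA -expr2 mulrCA.
  congr (_ * _); rewrite mulr_sumr; apply: eq_bigr => i _.
  by rewrite -big_split mulr_sumr.
rewrite ler_wpM2l ?sqr_ge0//; apply: ler_sum => i _; apply: ler_sum => j _.
apply: le_trans (ler_norm _) _.
case: (dependent y i j); last first.
  rewrite subr0 mul1r add0r; apply: (max_exponent_bound _ _ Hq) => //.
    exact: alpha_mix_ge0.
  by move=> r r2 Hr; apply: davydov; auto.
rewrite subrr mul0r addr0 mulr1.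
(* Any admissible exponent bounds the two second moments, whose sum [4 K^2] is within the allowed
   [10 K^2]. *)
have [r r2 Hr] := max_exponent_ex Hq.
have := second_moment_le K0 r2 (HF r r2 Hr i).
have := second_moment_le K0 r2 (HF r r2 Hr j).
have := cov_le_second_moments P (F i) (F j).
have := sqr_ge0 K; lra.
Qed.

(** * Decomposition of the estimators into treatment arms *)

Definition arm_prob i b : R := Pr P [set z : assignment n | z i == b]%SET.
Definition arm_weight i b z : R := (z i == b)%:R / arm_prob i b.
Definition arm_HT b z : R := n%:R^-1 * \sum_i arm_weight i b z * y i z.
(** The Hajek denominator divided by [n], so that its mean is 1. *)
Definition arm_size b z : R := n%:R^-1 * \sum_i arm_weight i b z.
Definition arm_mean b : R :=
  n%:R^-1 * \sum_i expect P (potential_outcome y i b).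

Lemma arm_prob_true i : arm_prob i true = treat_prob P i.
Proof. by congr (Pr P _); apply/setP => z; rewrite !inE eqb_id. Qed.

Lemma arm_prob_false i : arm_prob i false = 1 - treat_prob P i.
Proof.
rewrite -(expect_cst P 1) /treat_prob /arm_prob -!expect_indicator -expectB.
by apply: eq_expect => z; rewrite !inE; case: (z i); rewrite ?subrr ?subr0.
Qed.

Lemma tau_EATE_arms : tau_EATE P y = arm_mean true - arm_mean false.
Proof.
rewrite /tau_EATE /arm_mean -mulrBr -sumrB; congr (_ * _).
by apply: eq_bigr => i _; rewrite expectB.
Qed.

Lemma arm_weight_true i z : arm_weight i true z = (z i)%:R / treat_prob P i.
Proof. by rewrite /arm_weight arm_prob_true eqb_id. Qed.

Lemma arm_weight_false i z :
  arm_weight i false z = (1 - (z i)%:R) / (1 - treat_prob P i).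
Proof.
by rewrite /arm_weight arm_prob_false; case: (z i); rewrite ?subrr ?subr0.
Qed.

Lemma tau_HT_arms z : tau_HT P y z = arm_HT true z - arm_HT false z.
Proof.
by congr (_ * _ - _ * _); apply: eq_bigr => i _;
  rewrite ?arm_weight_true ?arm_weight_false mulrAC.
Qed.

Lemma tau_HA_arms z : (0 < n)%N ->
  tau_HA P y z = arm_HT true z / arm_size true z
                 - arm_HT false z / arm_size false z.
Proof.
move=> n0; rewrite /arm_HT /arm_size !invfM !mulrA.
(* Only [n] is cancelled; [b] may be 0, as happens for an empty arm. *)
have cancel_n (a b : R) : n%:R^-1 * a / n%:R^-1 / b = a / b.
  by congr (_ / _); field; rewrite pnatr_eq0 -lt0n.
rewrite !cancel_n; congr (_ / _ - _ / _); apply: eq_bigr => i _;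
  by rewrite ?arm_weight_true ?arm_weight_false ?mulrA// mulrAC.
Qed.

(** * Bias, variance and tail bounds under the regularity conditions *)

Section Regularity.
Variables (k : R) (q s : \bar R) (HQ HS : R -> Prop).
Hypotheses (n_gt0 : (0 < n)%N) (k_gt0 : 0 < k).
Hypothesis prob_bounds :
  forall i, k^-1 <= treat_prob P i /\ treat_prob P i <= 1 - k^-1.
Hypotheses (q_max : max_exponent 2 HQ q) (s_max : max_exponent 1 HS s).
Hypothesis HQ_moment : forall r, HQ r -> forall i, moment_le P k r (y i).
Hypothesis HS_moment :
  forall r, HS r -> forall i b, moment_le P k r (potential_outcome y i b).

Lemma arm_prob_ge i b : k^-1 <= arm_prob i b.
Proof.
have [h1 h2] := prob_bounds i.
by case: b; rewrite ?arm_prob_true ?arm_prob_false//; lra.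
Qed.

Lemma arm_prob_gt0 i b : 0 < arm_prob i b.
Proof. by apply: lt_le_trans (arm_prob_ge i b); rewrite invr_gt0. Qed.

Lemma arm_prob_inv_le i b : (arm_prob i b)^-1 <= k.
Proof. by rewrite invf_ple ?posrE ?arm_prob_gt0 ?arm_prob_ge. Qed.

Lemma arm_weight_le i b z : `|arm_weight i b z| <= k.
Proof.
rewrite /arm_weight; case: (z i == b); last by rewrite mul0r normr0 ltW.
by rewrite mul1r ger0_norm ?arm_prob_inv_le// invr_ge0 ltW ?arm_prob_gt0.
Qed.

Lemma moment_arm_weight i b r : 0 <= r -> moment_le P k r (arm_weight i b).
Proof.
move=> r0; rewrite /moment_le -[leRHS](expect_cst P); apply: ler_expect => z.
by rewrite ge0_ler_powR ?nnegrE ?arm_weight_le// ltW.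
Qed.

Lemma moment_arm_outcome i b r : 0 <= r -> moment_le P k r (y i) ->
  moment_le P (k ^+ 2) r (fun z => arm_weight i b z * y i z).
Proof.
move=> r0 Hy; rewrite /moment_le expr2 powRM ?(ltW k_gt0)//.
apply: (@le_trans _ _ (k `^ r * expect P (fun z => `|y i z| `^ r))).
  rewrite -expectZ; apply: ler_expect => z.
  rewrite normrM powRM// ler_wpM2r ?powR_ge0//.
  by rewrite ge0_ler_powR ?nnegrE ?arm_weight_le// ltW.
by rewrite ler_wpM2l ?powR_ge0.
Qed.

Lemma expect_arm_weight i b : expect P (arm_weight i b) = 1.
Proof.
rewrite (eq_expect P (Y := fun z => (arm_prob i b)^-1 *
  (z \in [set z : assignment n | z i == b]%SET)%:R)).
  by rewrite expectZ expect_indicator mulVf// gt_eqF ?arm_prob_gt0.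
by move=> z; rewrite inE mulrC.
Qed.

(** The weight vanishes unless [z i = b], where observed and potential outcomes coincide, and it has
    mean 1. The bias is thus exactly a covariance between the weight, bounded by [k], and the
    potential outcome. *)
Lemma bias_arm_outcome i b :
  `|expect P (fun z => arm_weight i b z * y i z)
    - expect P (potential_outcome y i b)|
  <= 6 * k ^+ 2 * pow00 (alpha_mix P (fun z : assignment n => z i) (exposure_vec_del y i))
                        (holder_exponent 1 s).
Proof.
have -> : expect P (fun z => arm_weight i b z * y i z)
    - expect P (potential_outcome y i b)
    = cov P (arm_weight i b) (potential_outcome y i b).
  rewrite /cov expect_arm_weight mul1r; congr (_ - _); apply: eq_expect => z.
  rewrite /arm_weight; case: eqVneq => [<-|_]; last by rewrite !mul0r.
  by rewrite potential_outcome_observed.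
have -> : 6 * k ^+ 2 = 6 * k * k by rewrite -mulrA.
apply: (max_exponent_bound _ _ s_max) => //; first exact: alpha_mix_ge0.
move=> r r1 Hr; apply: cov_le_alpha_bounded; rewrite ?k_gt0//.
- by move=> z z' zz'; rewrite /arm_weight zz'.
- exact: potential_outcome_determined.
- exact: arm_weight_le.
- exact: HS_moment.
Qed.

Lemma bias_arm_HT b :
  `|expect P (arm_HT b) - arm_mean b|
    <= 6 * k ^+ 2 * (n%:R^-1 * alpha_int P y s).
Proof.
rewrite /arm_HT /arm_mean expectZ expect_sum -mulrBr -sumrB normrM.
rewrite ger0_norm ?invr_ge0// mulrCA ler_wpM2l ?invr_ge0//.
apply: le_trans (ler_norm_sum _ _ _) _; rewrite /alpha_int big_distrr /=.
by apply: ler_sum => i _; apply: bias_arm_outcome.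
Qed.

Lemma arm_mean_le b : `|arm_mean b| <= 2 * k.
Proof.
rewrite /arm_mean normrM ger0_norm ?invr_ge0//.
rewrite mulrC ler_pdivrMr ?ltr0n//.
have -> : 2 * k * n%:R = \sum_(i < n) (2 * k).
  by rewrite sumr_const card_ord mulr_natr.
apply: le_trans (ler_norm_sum _ _ _) _; apply: ler_sum => i _.
have [r r1 Hr] := max_exponent_ex s_max.
apply: le_trans (normr_expect _ _) _.
by apply: (first_moment_le k_gt0 r1); apply: HS_moment.
Qed.

Lemma pow00_ge0 (a e : R) : 0 <= pow00 a e.
Proof. by rewrite /pow00; case: ifP; rewrite ?powR_ge0. Qed.

Lemma alpha_ext_ge0 : 0 <= alpha_ext P y q.
Proof.
rewrite mulr_ge0 ?invr_ge0//; apply: sumr_ge0 => i _; apply: sumr_ge0 => j _.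
by rewrite mulr_ge0 ?pow00_ge0//; case: (dependent y i j); rewrite ?subrr ?subr0.
Qed.

Lemma alpha_int_ge0 : 0 <= alpha_int P y s.
Proof. by apply: sumr_ge0 => i _; apply: pow00_ge0. Qed.

(** Each unit is dependent on itself. This keeps the rate positive, so that it can be cancelled in
    the [Op_rate] argument. *)
Lemma d_avg_gt0 : 0 < d_avg y.
Proof.
rewrite mulr_gt0 ?invr_gt0 ?ltr0n//.
pose i0 := Ordinal n_gt0; rewrite (bigD1 i0)//= (bigD1 i0)//=.
have -> : dependent y i0 i0 by apply/existsP; exists i0; rewrite /interferes eqxx.
by rewrite -addrA ltr_pwDl// addr_ge0 ?sumr_ge0// => i _; rewrite sumr_ge0.
Qed.

Lemma powR_half_prod (a : R) : 0 <= a ->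
  (n%:R `^ (- 2^-1) * a `^ 2^-1) ^+ 2 = n%:R^-1 * a.
Proof.
move=> a0; rewrite exprMn powRN exprVn !powR12_sqrt// !sqr_sqrtr//.
Qed.

(** The rate is a sum of three nonnegative terms, and its square dominates the sum of their squares.
    The left side has the shape of variance plus squared bias. *)
Lemma rate_sqr_ge :
  n%:R^-1 * (d_avg y + alpha_ext P y q) + (n%:R^-1 * alpha_int P y s) ^+ 2
    <= rate P y q s ^+ 2.
Proof.
rewrite mulrDr -(powR_half_prod (ltW d_avg_gt0)) -(powR_half_prod alpha_ext_ge0) /rate.
set u := _ * _ `^ _; set v := _ * _ `^ _; set w := _ * alpha_int _ _ _.
have u0 : 0 <= u by rewrite mulr_ge0 ?powR_ge0.
have v0 : 0 <= v by rewrite mulr_ge0 ?powR_ge0.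
have w0 : 0 <= w by rewrite mulr_ge0 ?invr_ge0 ?alpha_int_ge0.
have := mulr_ge0 u0 v0; have := mulr_ge0 u0 w0; have := mulr_ge0 v0 w0.
have -> : (u + v + w) ^+ 2 = u ^+ 2 + v ^+ 2 + w ^+ 2 + 2 * (u * v + u * w + v * w).
  by ring.
by move=> *; rewrite lerDl; lra.
Qed.

Lemma rate_gt0 : 0 < rate P y q s.
Proof.
rewrite /rate -addrA ltr_pwDl ?mulr_gt0 ?powR_gt0 ?ltr0n ?d_avg_gt0//.
by rewrite addr_ge0 ?mulr_ge0 ?powR_ge0 ?invr_ge0 ?alpha_int_ge0.
Qed.

Lemma rate_le (e : R) : 0 < e ->
  d_avg y <= (e / 3) ^+ 2 * n%:R -> alpha_ext P y q <= (e / 3) ^+ 2 * n%:R ->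
  alpha_int P y s <= e / 3 * n%:R -> rate P y q s <= e.
Proof.
move=> e0 hd he hi.
have half a : 0 <= a -> a <= (e / 3) ^+ 2 * n%:R ->
    n%:R `^ (- 2^-1) * a `^ 2^-1 <= e / 3.
  move=> a0 ha; rewrite -(@ler_pXn2r _ 2)// ?nnegrE ?mulr_ge0 ?powR_ge0 ?(ltW e0)//.
  by rewrite powR_half_prod// mulrC ler_pdivrMr ?ltr0n.
have h1 := half _ (ltW d_avg_gt0) hd; have h2 := half _ alpha_ext_ge0 he.
have h3 : n%:R^-1 * alpha_int P y s <= e / 3.
  by rewrite mulrC ler_pdivrMr ?ltr0n.
by rewrite /rate; lra.
Qed.

(** The variance gives [10 (k^2)^2], since weighted outcomes have moment constant [k^2], and the
    squared bias gives [(6 k^2)^2]; hence 46. *)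
Lemma arm_HT_mean_square b :
  expect P (fun z => (arm_HT b z - arm_mean b) ^+ 2)
    <= 46 * k ^+ 4 * rate P y q s ^+ 2.
Proof.
rewrite mean_square_dev.
have hvar : cov P (arm_HT b) (arm_HT b)
    <= 10 * (k ^+ 2) ^+ 2 * (n%:R^-1 * (d_avg y + alpha_ext P y q)).
  apply: (variance_mean _ q_max) => [|i|r r2 Hr i]; first by rewrite exprn_gt0.
    move=> z z' zz'; congr (_ * _); last exact: outcome_determined zz'.
    exact: (treatment_determined (fun c => (c == b)%:R / arm_prob i b) zz').
  by apply: moment_arm_outcome; [lra | exact: HQ_moment].
have hbias : (expect P (arm_HT b) - arm_mean b) ^+ 2
    <= 36 * k ^+ 4 * (n%:R^-1 * alpha_int P y s) ^+ 2.
  have -> : 36 * k ^+ 4 * (n%:R^-1 * alpha_int P y s) ^+ 2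
    = (6 * k ^+ 2 * (n%:R^-1 * alpha_int P y s)) ^+ 2 by ring.
  rewrite -(real_normK (num_real (_ - _))) lerXn2r ?nnegrE ?bias_arm_HT//.
  by rewrite !mulr_ge0 ?invr_ge0 ?alpha_int_ge0 ?(ltW k_gt0).
have k4 : 0 <= k ^+ 4 by rewrite exprn_ge0 ?ltW.
have V0 : 0 <= n%:R^-1 * (d_avg y + alpha_ext P y q).
  by rewrite mulr_ge0 ?invr_ge0// addr_ge0 ?alpha_ext_ge0 ?ltW ?d_avg_gt0.
move: hvar hbias; rewrite -exprM => hvar hbias.
apply: (le_trans (lerD hvar hbias)).
apply: le_trans (ler_wpM2l _ rate_sqr_ge); last by rewrite mulr_ge0.
have := mulr_ge0 k4 V0; have := mulr_ge0 k4 (sqr_ge0 (n%:R^-1 * alpha_int P y s)).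
by move=> *; rewrite -!mulrA mulrDr; lra.
Qed.

(** The weights have mean exactly 1, so only the variance remains. *)
Lemma arm_size_mean_square b :
  expect P (fun z => (arm_size b z - 1) ^+ 2)
    <= 10 * k ^+ 2 * rate P y q s ^+ 2.
Proof.
rewrite mean_square_dev.
have -> : expect P (arm_size b) = 1.
  rewrite /arm_size expectZ expect_sum.
  rewrite (eq_bigr (fun=> 1)) => [|i _]; last exact: expect_arm_weight.
  by rewrite sumr_const card_ord mulVf// pnatr_eq0 -lt0n.
rewrite subrr expr0n addr0.
apply: le_trans (variance_mean k_gt0 q_max _ _) _.
- by move=> i; apply: (treatment_determined (fun c => (c == b)%:R / arm_prob i b)).
- by move=> r r2 _ i; apply: moment_arm_weight; lra.
rewrite ler_wpM2l ?mulr_ge0 ?(ltW k_gt0)//; apply: le_trans rate_sqr_ge.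
by rewrite lerDl sqr_ge0.
Qed.

(* Chosen to cover the Hajek estimator, whose bound exceeds the
   Horvitz-Thompson one. *)
Definition tail_const : R := 11008 * k ^+ 4 + 80 * k ^+ 2.

Lemma tau_HT_tail (t : R) : 0 < t ->
  Pr P [set z | t < `|tau_HT P y z - tau_EATE P y|]%SET
    <= tail_const * (rate P y q s ^+ 2 / t ^+ 2 + rate P y q s ^+ 2).
Proof.
move=> t0; have t20 : 0 < t / 2 by rewrite divr_gt0.
pose E b := [set z | t / 2 < `|arm_HT b z - arm_mean b|]%SET.
have hE b : Pr P (E b) <= 184 * k ^+ 4 * (rate P y q s ^+ 2 / t ^+ 2).
  apply: le_trans (chebyshev_Pr _ _ t20) _.
  rewrite ler_pdivrMr ?exprn_gt0//; apply: le_trans (arm_HT_mean_square b) _.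
  by rewrite le_eqVlt; apply/orP; left; apply/eqP; field; rewrite gt_eqF.
apply: (@le_trans _ _ (Pr P (E true :|: E false)%SET)).
  apply: le_Pr; apply/fintype.subsetP => z; rewrite !inE => ht.
  rewrite !ltNge -negb_and; apply/negP => /andP[h1 h2].
  move: ht; rewrite ltNge => /negP; apply.
  rewrite tau_HT_arms tau_EATE_arms.
  have -> : arm_HT true z - arm_HT false z - (arm_mean true - arm_mean false)
    = (arm_HT true z - arm_mean true) - (arm_HT false z - arm_mean false) by ring.
  by apply: le_trans (ler_normB _ _) _; lra.
apply: le_trans (Pr_setU _ _ _) _; apply: le_trans (lerD (hE true) (hE false)) _.
rewrite /tail_const; set r := rate _ _ _ _.
have k4 : 0 <= k ^+ 4 by rewrite exprn_ge0 ?ltW.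
have k2 : 0 <= k ^+ 2 by rewrite sqr_ge0.
have r0 : 0 <= r ^+ 2 by rewrite sqr_ge0.
have rt : 0 <= r ^+ 2 / t ^+ 2 by rewrite divr_ge0 ?sqr_ge0.
have := mulr_ge0 k4 rt; have := mulr_ge0 k2 rt.
have := mulr_ge0 k4 r0; have := mulr_ge0 k2 r0.
lra.
Qed.

(** With [A], [B], [m] for numerator, denominator and target,
    [A / B - m = ((A - m) - m (B - 1)) / B]. Outside [E1] and [E2] both terms of the numerator are
    at most [t / 4], as [|m| <= 2 k]; outside [E3], [B] is at least 1/2. The event [E3] does not
    involve [t], whence the separate term in [rate^2]. *)
Lemma arm_ratio_tail b (t : R) : 0 < t ->
  Pr P [set z | t < `|arm_HT b z / arm_size b z - arm_mean b|]%SET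
    <= (1376 * k ^+ 4) * (rate P y q s ^+ 2 / t ^+ 2)
       + 40 * k ^+ 2 * rate P y q s ^+ 2.
Proof.
move=> t0; have t40 : 0 < t / 4 by rewrite divr_gt0.
have t8k0 : 0 < t / (8 * k) by rewrite divr_gt0 ?mulr_gt0.
pose E1 := [set z | t / 4 < `|arm_HT b z - arm_mean b|]%SET.
pose E2 := [set z | t / (8 * k) < `|arm_size b z - 1|]%SET.
pose E3 := [set z | 2^-1 < `|arm_size b z - 1|]%SET.
have h1 : Pr P E1 <= 736 * k ^+ 4 * (rate P y q s ^+ 2 / t ^+ 2).
  apply: le_trans (chebyshev_Pr _ _ t40) _.
  rewrite ler_pdivrMr ?exprn_gt0//; apply: le_trans (arm_HT_mean_square b) _.
  by rewrite le_eqVlt; apply/orP; left; apply/eqP; field; rewrite gt_eqF.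
have h2 : Pr P E2 <= 640 * k ^+ 4 * (rate P y q s ^+ 2 / t ^+ 2).
  apply: le_trans (chebyshev_Pr _ _ t8k0) _.
  rewrite ler_pdivrMr ?exprn_gt0//; apply: le_trans (arm_size_mean_square b) _.
  by rewrite le_eqVlt; apply/orP; left; apply/eqP; field; rewrite !gt_eqF.
have h3 : Pr P E3 <= 40 * k ^+ 2 * rate P y q s ^+ 2.
  apply: le_trans (chebyshev_Pr _ _ _) _; first by rewrite invr_gt0.
  rewrite ler_pdivrMr ?exprn_gt0 ?invr_gt0//.
  apply: le_trans (arm_size_mean_square b) _.
  by rewrite le_eqVlt; apply/orP; left; apply/eqP; field.
apply: (@le_trans _ _ (Pr P (E1 :|: E2 :|: E3)%SET)); last first.
  apply: le_trans (Pr_setU _ _ _) _.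
  by have := Pr_setU P E1 E2; lra.
apply: le_Pr; apply/fintype.subsetP => z; rewrite !inE => ht.
rewrite !ltNge -!negb_and; apply/negP => /andP[/andP[e1 e2] e3].
move: ht; rewrite ltNge => /negP; apply.
move: e1 e2 e3 (arm_mean_le b).
set A := arm_HT b z; set B := arm_size b z; set m := arm_mean b => e1 e2 e3 hm.
have B_ge : 2^-1 <= B by move: e3; rewrite ler_norml => /andP[? _]; lra.
have B_gt0 : 0 < B by apply: lt_le_trans B_ge; rewrite invr_gt0.
have -> : A / B - m = ((A - m) - m * (B - 1)) / B by field; rewrite gt_eqF.
rewrite normrM normfV (gtr0_norm B_gt0) ler_pdivrMr//.
apply: (@le_trans _ _ (t * 2^-1)); last by rewrite ler_wpM2l// ltW.
apply: le_trans (ler_normB _ _) _; rewrite normrM.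
have : `|m| * `|B - 1| <= 2 * k * (t / (8 * k)) by apply: ler_pM.
have -> : 2 * k * (t / (8 * k)) = t / 4 by field; rewrite gt_eqF.
lra.
Qed.

Lemma tau_HA_tail (t : R) : 0 < t ->
  Pr P [set z | t < `|tau_HA P y z - tau_EATE P y|]%SET
    <= tail_const * (rate P y q s ^+ 2 / t ^+ 2 + rate P y q s ^+ 2).
Proof.
move=> t0; have t20 : 0 < t / 2 by rewrite divr_gt0.
pose E b := [set z | t / 2 < `|arm_HT b z / arm_size b z - arm_mean b|]%SET.
(* Halving [t] multiplies 1376 by 4; the two arms then add up to [tail_const]. *)
have hE b : Pr P (E b) <= 5504 * k ^+ 4 * (rate P y q s ^+ 2 / t ^+ 2)
                          + 40 * k ^+ 2 * rate P y q s ^+ 2.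
  apply: le_trans (arm_ratio_tail _ t20) _.
  by rewrite le_eqVlt; apply/orP; left; apply/eqP; field; rewrite gt_eqF.
apply: (@le_trans _ _ (Pr P (E true :|: E false)%SET)).
  apply: le_Pr; apply/fintype.subsetP => z; rewrite !inE => ht.
  rewrite !ltNge -negb_and; apply/negP => /andP[h1 h2].
  move: ht; rewrite ltNge => /negP; apply.
  rewrite tau_HA_arms// tau_EATE_arms.
  rewrite (_ : _ - _ - _ =
    (arm_HT true z / arm_size true z - arm_mean true)
    - (arm_HT false z / arm_size false z - arm_mean false)); last by ring.
  by apply: le_trans (ler_normB _ _) _; lra.
apply: le_trans (Pr_setU _ _ _) _; apply: le_trans (lerD (hE true) (hE false)) _.
rewrite /tail_const; set r := rate _ _ _ _.
have k4 : 0 <= k ^+ 4 by rewrite exprn_ge0 ?ltW.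
have k2 : 0 <= k ^+ 2 by rewrite sqr_ge0.
have r0 : 0 <= r ^+ 2 by rewrite sqr_ge0.
have rt : 0 <= r ^+ 2 / t ^+ 2 by rewrite divr_ge0 ?sqr_ge0.
have := mulr_ge0 k4 rt; have := mulr_ge0 k2 rt.
have := mulr_ge0 k4 r0; have := mulr_ge0 k2 r0.
lra.
Qed.

End Regularity.
End FixedSampleSize.

(** * From tail bounds to asymptotic statements *)

(** A fixed [t] gives convergence in probability. Taking [t = M a n] leaves [C / M^2 + C (a n)^2],
    where a large [M] controls the first term and a large [n] the second. *)
Lemma cvg_Op_of_tail (R : realType) (P : forall n, design R n)
    (X : forall n, assignment n -> R) (a : nat -> R) (C : R) :
  0 < C -> (forall n, (0 < n)%N -> 0 < a n) ->
  (forall e : R, 0 < e -> \forall n \near \oo, a n <= e) ->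
  (forall n, (0 < n)%N -> forall t : R, 0 < t ->
     Pr (P n) [set z | t < `|X n z|]%SET <= C * (a n ^+ 2 / t ^+ 2 + a n ^+ 2)) ->
  cvg_in_prob0 P X /\ Op_rate P X a.
Proof.
move=> C0 a_gt0 a_small tailX.
have sqr_small (e : R) : 0 < e -> \forall n \near \oo, a n ^+ 2 <= e.
  move=> e0; near=> n.
  have n0 : (0 < n)%N by near: n; exact: nbhs_infty_gt.
  have -> : e = Num.sqrt e ^+ 2 by rewrite sqr_sqrtr ?ltW.
  rewrite ler_pXn2r ?nnegrE ?sqrtr_ge0 ?(ltW (a_gt0 _ n0))//.
  by near: n; apply: a_small; rewrite sqrtr_gt0.
split=> e e0.
  have e2 : 0 < (e ^+ 2)^-1 + 1 by rewrite addr_gt0 ?invr_gt0 ?exprn_gt0.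
  apply/cvgrPdist_le => d d0; near=> n.
  have n0 : (0 < n)%N by near: n; exact: nbhs_infty_gt.
  rewrite sub0r normrN ger0_norm ?Pr_ge0//.
  apply: le_trans (tailX n n0 e e0) _.
  have -> : a n ^+ 2 / e ^+ 2 + a n ^+ 2 = a n ^+ 2 * ((e ^+ 2)^-1 + 1) by ring.
  rewrite mulrC -mulrA -ler_pdivlMr ?mulr_gt0//.
  by near: n; apply: sqr_small; rewrite divr_gt0 ?mulr_gt0.
(* Then [M^2 >= 2 C / e], so that [C / M^2] is at most [e / 2]. *)
pose M := 1 + 2 * C / e.
have C2e : 0 < 2 * C / e by rewrite divr_gt0 ?mulr_gt0.
have M0 : 0 < M by rewrite addr_gt0.
exists M; near=> n.
have n0 : (0 < n)%N by near: n; exact: nbhs_infty_gt.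
have an0 := a_gt0 n n0.
apply: le_trans (tailX n n0 _ (mulr_gt0 M0 an0)) _.
have -> : a n ^+ 2 / (M * a n) ^+ 2 = (M ^+ 2)^-1 by field; rewrite !gt_eqF.
have hM : C * (M ^+ 2)^-1 <= e / 2.
  rewrite ler_pdivrMr ?exprn_gt0//.
  have -> : C = e / 2 * (2 * C / e) by field; rewrite gt_eqF.
  rewrite ler_wpM2l ?divr_ge0 ?(ltW e0)//.
  by rewrite /M sqrrD expr1n mul1r; have := sqr_ge0 (2 * C / e); lra.
have ha : C * a n ^+ 2 <= e / 2.
  rewrite mulrC -ler_pdivlMr//.
  by near: n; apply: sqr_small; rewrite !divr_gt0 ?ltr0n.
by rewrite mulrDr; lra.
Unshelve. all: by end_near.
Qed.

Theorem proposition5 (R : realType)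
    (P : forall n, design R n) (y : forall n, 'I_n -> assignment n -> R)
    (k : R) (q s : \bar R)
    (hreg : regular P y k q s)
    (hd : (fun n => d_avg (y n)) =o_\oo (fun n => n%:R : R))
    (hext : (fun n => alpha_ext (P n) (y n) q) =o_\oo (fun n => n%:R : R))
    (hint : (fun n => alpha_int (P n) (y n) s) =o_\oo (fun n => n%:R : R)) :
  [/\ cvg_in_prob0 P
        (fun n z => tau_HT (P n) (y n) z - tau_EATE (P n) (y n)),
      cvg_in_prob0 P
        (fun n z => tau_HA (P n) (y n) z - tau_EATE (P n) (y n)),
      Op_rate P (fun n z => tau_HT (P n) (y n) z - tau_EATE (P n) (y n))
        (fun n => rate (P n) (y n) q s) &
      Op_rate P (fun n z => tau_HA (P n) (y n) z - tau_EATE (P n) (y n))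
        (fun n => rate (P n) (y n) q s)].
Proof.
have [k0 hp q_max s_max] := hreg.
(* The maximal exponents belong to the whole sequence; each [n] inherits the moment bounds with the
   same [k], which makes the tail constant uniform in [n]. *)
have hQ n r : outcome_moment P y k r -> forall i, moment_le (P n) k r (@y n i).
  by move=> H i; apply: H.
have hS n r : potential_moment P y k r ->
    forall i b, moment_le (P n) k r (potential_outcome (@y n) i b).
  by move=> H i b; apply: H.
have C0 : 0 < tail_const k.
  have k4 : 0 < k ^+ 4 by rewrite exprn_gt0.
  have k2 : 0 < k ^+ 2 by rewrite exprn_gt0.
  by rewrite /tail_const; lra.
have r_gt0 n : (0 < n)%N -> 0 < rate (P n) (y n) q s.
  by move=> n0; apply: rate_gt0.
(* Each of the three terms of the rate is brought below [e / 3]; the first two are square roots,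
   hence the threshold [(e / 3)^2]. *)
have r_small (e : R) : 0 < e -> \forall n \near \oo, rate (P n) (y n) q s <= e.
  move=> e0; have e3 : 0 < e / 3 by rewrite divr_gt0.
  have e32 : 0 < (e / 3) ^+ 2 by rewrite exprn_gt0.
  move/eqoP: hd => /(_ _ e32) hd'; move/eqoP: hext => /(_ _ e32) hext'.
  move/eqoP: hint => /(_ _ e3) hint'.
  near=> n; have n0 : (0 < n)%N by near: n; exact: nbhs_infty_gt.
  have drop_norm (x c : R) : `|x| <= c * `|n%:R : R| -> x <= c * n%:R.
    by rewrite [`|n%:R|]ger0_norm//; apply: le_trans (ler_norm x).
  by apply: rate_le => //; apply: drop_norm; near: n.
have [HT1 HT2] := cvg_Op_of_tail C0 r_gt0 r_small (fun n n0 t t0 =>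
  tau_HT_tail n0 k0 (hp n) q_max s_max (hQ n) (hS n) t0).
have [HA1 HA2] := cvg_Op_of_tail C0 r_gt0 r_small (fun n n0 t t0 =>
  tau_HA_tail n0 k0 (hp n) q_max s_max (hQ n) (hS n) t0).
by split.
Unshelve. all: by end_near.
Qed.
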